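(* Consider a two-layer multilayer network game with intra-layer matrices $G^{(1)},G^{(2)}\in\mathbb{R}^{N\times N}$ (zero diagonals) and inter-layer matrices $G^{(12)},G^{(21)}\in\mathbb{R}^{N\times N}$. Suppose that either 1. at least one of $I+G^{(1)}$, $I+G^{(2)}$ is not a P-matrix (equivalently, at least one of the layers by itself is not guaranteed to have a unique Nash equilibrium); or 2. both $I+G^{(1)}$ and $I+G^{(2)}$ are P-matrices, but $$\det\bigl(I+G^{(1)}-G^{(12)}(I+G^{(2)})^{-1}G^{(21)}\bigr)\leq 0\quad\text{or}\quad \det\bigl(I+G^{(2)}-G^{(21)}(I+G^{(1)})^{-1}G^{(12)}\bigr)\leq 0.$$ Then the multilayer network game is not guaranteed to have a unique Nash equilibrium; that is, there exist benefit functions and unit costs for which it either has no Nash equilibrium or has multiple Nash equilibria.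
   Context: A square real matrix is a P-matrix if all its principal minors are strictly positive. Multilayer network game: there are $N$ agents; agent $i$ chooses an effort $x_i^{(l)}\in\mathbb{R}_{\geq0}$ in each layer $l\in\{1,2\}$. Entries of $G^{(l)}$ and of the inter-layer matrices $G^{(lk)}$ have arbitrary sign. Agent $i$'s utility from layer $l$ (with $k$ the other layer) is $$u_i^{(l)}=b_i^{(l)}\Bigl(x_i^{(l)}+\sum_{j=1}^N g^{(l)}_{ij}x_j^{(l)}+\sum_{j=1}^N g^{(lk)}_{ij}x_j^{(k)}\Bigr)-c_i^{(l)}x_i^{(l)},$$ and its total utility is $\kappa u_i^{(1)}+(1-\kappa)u_i^{(2)}$. Each benefit function $b_i^{(l)}:\mathbb{R}\to\mathbb{R}$ is twice differentiable, strictly increasing and strictly concave, $c_i^{(l)}>0$, and it is assumed that there is a (necessarily unique) $q_i^{(l)}\in\mathbb{R}$ with $(b_i^{(l)})'(q_i^{(l)})=c_i^{(l)}$. Nash equilibria of the game are the solutions of the linear best-reply system: vectors $\mathbf{x}^*=(\mathbf{x}^{*(1)},\mathbf{x}^{*(2)})\in\mathbb{R}^{2N}_{\geq 0}$ with $\mathbf{x}^*=\max\{\mathbf{0},\,\mathbf{q}-\mathbf{G}\mathbf{x}^*\}$ componentwise, where $\mathbf{q}=(\mathbf{q}^{(1)},\mathbf{q}^{(2)})$ and $\mathbf{G}=\begin{pmatrix} G^{(1)} & G^{(12)} \\ G^{(21)} & G^{(2)} \end{pmatrix}$. The game on layer $l$ by itself is the game whose equilibria are $\mathbf{x}\in\mathbb{R}^N_{\ge0}$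 with $\mathbf{x}=\max\{\mathbf 0,\mathbf{q}^{(l)}-G^{(l)}\mathbf{x}\}$; ''guaranteed'' means for all admissible benefit functions and unit costs. *)

(* Defs.v *)
From mathcomp Require Import all_boot all_order all_algebra.
From mathcomp Require Import all_classical all_reals all_analysis.
Import Order.TTheory GRing.Theory Num.Theory.
Import numFieldNormedType.Exports.

Set Implicit Arguments.
Unset Strict Implicit.
Unset Printing Implicit Defensive.

Local Open Scope ring_scope.

(* For S = set0 the minor is the determinant of a 0 x 0 matrix, which is 1. *)
Definition principal_minor (R : realType) (n : nat) (A : 'M[R]_n)
    (S : {set 'I_n}) : R :=
  \det (mxsub (fun i : 'I_#|S| => enum_val i) (fun i : 'I_#|S| => enum_val i) A).

Definition P_matrix (R : realType) (n : nat) (A : 'M[R]_n) : Prop :=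
  forall S : {set 'I_n}, 0 < principal_minor A S.

Definition strictly_concave (R : realType) (b : R -> R) : Prop :=
  forall x y t : R, x != y -> 0 < t -> t < 1 ->
    t * b x + (1 - t) * b y < b (t * x + (1 - t) * y).

Definition admissible (R : realType) (b : R -> R) (c : R) : Prop :=
  [/\ (forall x : R, derivable b x 1) /\ (forall x : R, derivable b^`()%classic x 1),
      {homo b : x y / x < y},
      strictly_concave b,
      0 < c
    & exists q : R, b^`()%classic q = c].

(* x = max {0, q - G x} componentwise, with x >= 0. *)
Definition best_reply (R : realType) (n : nat) (G : 'M[R]_n) (q x : 'cV[R]_n) : Prop :=
  (forall i : 'I_n, 0 <= x i 0) /\
  (forall i : 'I_n, x i 0 = Num.max 0 ((q - G *m x) i 0)).

(* The vector q of optimal net effort levels is determined by the benefit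
   functions and unit costs: each b i has a strictly decreasing derivative,
   so q i is the only solution of b_i'(q_i) = c_i. *)
Definition target (R : realType) (n : nat) (b : 'I_n -> R -> R) (c : 'I_n -> R)
    (q : 'cV[R]_n) : Prop :=
  forall i : 'I_n, (b i)^`()%classic (q i 0) = c i.

Definition layer_nash (R : realType) (N : nat) (G : 'M[R]_N)
    (b : 'I_N -> R -> R) (c : 'I_N -> R) (x : 'cV[R]_N) : Prop :=
  exists q : 'cV[R]_N, target b c q /\ best_reply G q x.

Definition layer_guaranteed_unique_nash (R : realType) (N : nat) (G : 'M[R]_N) : Prop :=
  forall (b : 'I_N -> R -> R) (c : 'I_N -> R),
    (forall i : 'I_N, admissible (b i) (c i)) ->
    exists! x : 'cV[R]_N, layer_nash G b c x.

(* An effort profile stacks the two layers: the first N entries of x are the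
   efforts in layer 1, the last N those in layer 2. *)
Definition multilayer_nash (R : realType) (N : nat) (G1 G12 G21 G2 : 'M[R]_N)
    (b1 : 'I_N -> R -> R) (c1 : 'I_N -> R)
    (b2 : 'I_N -> R -> R) (c2 : 'I_N -> R) (x : 'cV[R]_(N + N)) : Prop :=
  exists q1 q2 : 'cV[R]_N,
    [/\ target b1 c1 q1, target b2 c2 q2
      & best_reply (block_mx G1 G12 G21 G2) (col_mx q1 q2) x].

(* Main.v *)
(** Best replies are the solutions of the linear complementarity problem
    [x >= 0], [w = M x - q >= 0], [x_i w_i = 0] with [M = I + G].

    If [M] is a P-matrix, no nonzero [z] satisfies [z_i (M z)_i <= 0] for all
    [i]: such a [z] lies in the kernel of a matrix whose rows are nonnegative
    nontrivial combinations of those of [M] and [I], and whose determinant is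
    therefore positive.  Differences of two solutions are of this kind, which
    gives uniqueness; the same fact yields existence by induction on the number
    of complementarity conditions, the other coordinates being pinned to
    [x_i = 0] or [w_i = 0].

    If [M] is not a P-matrix, take [B] minimal with nonpositive principal minor
    and [k] in [B].  A column of an adjugate matrix gives [z] supported on [B]
    with [z_k > 0], [(M z)_k <= 0] and [(M z)_i = 0] for the other [i] in [B];
    then [x] and [x + z] are both solutions for a suitable [q].

    For the two-layer game, the hypotheses prevent the block matrix from being
    a P-matrix (through its diagonal blocks or its determinant, by the Schur
    complement formula), and every [q] is realized by the benefit
    [- exp (- x)] with unit cost [exp (- q)]. *)
Require Import Defs.
From mathcomp Require Import all_boot all_order all_algebra.
From mathcomp Require Import all_classical all_reals all_analysis.
From mathcomp Require Import fingroup perm ring lra.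
Import Order.TTheory GRing.Theory Num.Theory.
Import numFieldNormedType.Exports.
Local Open Scope ring_scope.

Set Implicit Arguments.
Unset Strict Implicit.

(** * Principal minors as determinants of full size *)

Definition mix_mx (R : pzRingType) (n : nat) (M : 'M[R]_n) (A : {set 'I_n}) : 'M[R]_n :=
  \matrix_(i, j) if i \in A then M i j else (i == j)%:R.

Definition comb_mx (R : pzRingType) (n : nat) (M : 'M[R]_n) (a b : 'I_n -> R) : 'M[R]_n :=
  \matrix_(i, j) (a i * M i j + b i * (i == j)%:R).

Lemma det_mxsub_bij (R : comPzRingType) (m n : nat) (f : 'I_m -> 'I_n) (M : 'M[R]_n) :
  injective f -> m = n -> \det (mxsub f f M) = \det M.
Proof.
move=> f_inj mn; case: n / mn f M f_inj => f M f_inj.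
have -> : mxsub f f M = row_perm (perm f_inj) (col_perm (perm f_inj) M).
  by apply/matrixP => i j; rewrite !mxE !permE.
rewrite row_permE col_permE !det_mulmx !det_perm mulrCA -signr_addb odd_permV.
by rewrite addbb mulr1.
Qed.

(** Listing the indices of [A] before the others makes [mix_mx M A] block upper triangular, with the
    principal submatrix and an identity block on the diagonal. Minors thus become determinants of
    one fixed size, comparable row by row. *)
Lemma det_mix_mx (R : realType) (n : nat) (M : 'M[R]_n) (A : {set 'I_n}) :
  \det (mix_mx M A) = principal_minor M A.
Proof.
pose f (i : 'I_(#|A| + #|~: A|)) : 'I_n :=
  match fintype.split i with inl j => enum_val j | inr j => enum_val j end.
have fl j : f (lshift _ j) = enum_val j by rewrite /f (unsplitK (inl j)).
have fr j : f (rshift _ j) = enum_val j by rewrite /f (unsplitK (inr j)).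
have inA (j : 'I_#|A|) : enum_val j \in A by exact: enum_valP.
have inAc (j : 'I_#|~: A|) : (enum_val j \in A) = false.
  by have := enum_valP j; rewrite inE => /negbTE.
have f_inj : injective f.
  move=> i j; case: (split_ordP i) => i' ->; case: (split_ordP j) => j' ->;
    rewrite ?fl ?fr => ij.
  - by rewrite (enum_val_inj ij).
  - by have := inA i'; rewrite ij inAc.
  - by have := inA j'; rewrite -ij inAc.
  - by rewrite (enum_val_inj ij).
have cardA : (#|A| + #|~: A| = n)%N by rewrite cardsC card_ord.
rewrite -(det_mxsub_bij (mix_mx M A) f_inj cardA).
rewrite -[mxsub f f _]submxK.
have -> : dlsubmx (mxsub f f (mix_mx M A)) = 0.
  apply/matrixP => i j; rewrite !mxE fl fr inAc.
  by case: eqP => // ij; have := inA j; rewrite -ij inAc.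
have -> : drsubmx (mxsub f f (mix_mx M A)) = 1%:M.
  apply/matrixP => i j; rewrite !mxE !fr inAc.
  by rewrite (inj_eq enum_val_inj).
rewrite det_ublock det1 mulr1; congr (\det _).
by apply/matrixP => i j; rewrite !mxE !fl inA.
Qed.

Lemma P_matrix_mixP (R : realType) (n : nat) (M : 'M[R]_n) :
  P_matrix M <-> forall A, 0 < \det (mix_mx M A).
Proof. by split=> PM A; move: (PM A); rewrite det_mix_mx. Qed.

(** By induction on the number of rows that are neither a row of [M] nor an identity row: linearity
    in such a row [k] splits the determinant, with weights [a k] and [b k], into two with fewer
    mixed rows. Without mixed rows it is a principal minor. *)
Lemma P_matrix_det_comb_gt0 (R : realType) (n : nat) (M : 'M[R]_n) (a b : 'I_n -> R) :
  P_matrix M -> (forall i, [/\ 0 <= a i, 0 <= b i & 0 < a i + b i]) ->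
  0 < \det (comb_mx M a b).
Proof.
move=> /P_matrix_mixP PM.
pose pure (a b : 'I_n -> R) i := ((a i == 1) && (b i == 0)) || ((a i == 0) && (b i == 1)).
have [m] := ubnP #|[set i | ~~ pure a b i]|.
elim: m a b => // m IHm a b; rewrite ltnS => le_m ab.
have [/existsP[k nk]|/existsPn allpure] := boolP [exists k, ~~ pure a b k]; last first.
  suff -> : comb_mx M a b = mix_mx M [set i | a i == 1] by [].
  apply/matrixP => i j; rewrite !mxE inE.
  have := allpure i; rewrite negbK => /orP[] /andP[/eqP -> /eqP ->].
    by rewrite eqxx mul1r mul0r addr0.
  by rewrite [0 == _]eq_sym oner_eq0 mul1r mul0r add0r.
pose set_at (f : 'I_n -> R) v i := if i == k then v else f i.
have step u v : (u == 1) && (v == 0) || (u == 0) && (v == 1) ->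
    0 < \det (comb_mx M (set_at a u) (set_at b v)).
  move=> uv; apply: IHm.
    apply: leq_trans le_m; apply: proper_card; apply/properP; split.
      apply/fintype.subsetP => i; rewrite !inE /pure /set_at.
      by case: (i =P k) => // _; rewrite uv.
    by exists k; rewrite !inE // /pure /set_at eqxx uv.
  move=> i; rewrite /set_at; case: (i =P k) => // _.
  by case/orP: uv => /andP[/eqP -> /eqP ->]; rewrite ?addr0 ?add0r.
rewrite (determinant_multilinear (B := comb_mx M (set_at a 1) (set_at b 0))
   (C := comb_mx M (set_at a 0) (set_at b 1)) (i0 := k) (b := a k) (c := b k)).
- have p1 : 0 < \det (comb_mx M (set_at a 1) (set_at b 0)) by apply: step; rewrite !eqxx.
  have p2 : 0 < \det (comb_mx M (set_at a 0) (set_at b 1)) by apply: step; rewrite !eqxx orbT.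
  have [ak bk abk] := ab k.
  move: ak; rewrite le_eqVlt => /orP[/eqP a0|ak].
    by rewrite -a0 add0r in abk; rewrite -a0 mul0r add0r mulr_gt0.
  by apply: ltr_pwDl; [exact: mulr_gt0 | rewrite mulr_ge0 // ltW].
- apply/rowP => j; rewrite !mxE /set_at eqxx; ring.
- by apply/matrixP => i j; rewrite !mxE /set_at !(eq_sym _ k) (negbTE (neq_lift _ _)).
- by apply/matrixP => i j; rewrite !mxE /set_at !(eq_sym _ k) (negbTE (neq_lift _ _)).
Qed.

(** * Vectors whose signs a P-matrix reverses *)

Lemma row_id_mul (R : pzRingType) (n : nat) (i : 'I_n) (x : 'I_n -> R) :
  \sum_j (i == j)%:R * x j = x i.
Proof.
rewrite (bigD1 i) //= eqxx mul1r big1 ?addr0 // => j ji.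
by rewrite eq_sym (negbTE ji) mul0r.
Qed.

Lemma mix_mx_mul (R : pzRingType) (n : nat) (M : 'M[R]_n) (A : {set 'I_n})
    (x : 'cV[R]_n) (i : 'I_n) :
  (mix_mx M A *m x) i 0 = if i \in A then (M *m x) i 0 else x i 0.
Proof.
rewrite !mxE; case: ifP => iA.
  by apply: eq_bigr => j _; rewrite mxE iA.
rewrite -[RHS](row_id_mul i (x ^~ 0)).
by apply: eq_bigr => j _; rewrite mxE iA.
Qed.

Lemma unitmx_mul0 (R : fieldType) (n : nat) (M : 'M[R]_n) (x : 'cV[R]_n) :
  \det M != 0 -> M *m x = 0 -> x = 0.
Proof.
rewrite -unitfE -[_ \in _]/(M \in unitmx) => uM Mx.
by rewrite -[x](mulKmx uM) Mx mulmx0.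
Qed.

Lemma P_matrix_sign_reversal (R : realType) (n : nat) (M : 'M[R]_n) (z : 'cV[R]_n) :
  P_matrix M -> (forall i, z i 0 * (M *m z) i 0 <= 0) -> z = 0.
Proof.
move=> PM zle.
pose w i := (M *m z) i 0.
(* As [z i] and [w i] have opposite signs, [|z i| w i + |w i| z i = 0], which puts [z] in the kernel
   of [comb_mx M a b]. Where both vanish, the weight 1 keeps the sum of the weights positive. *)
pose s i := (z i 0 == 0) && (w i == 0).
pose a i := if s i then 1 else `|z i 0|.
pose b i := `|w i|.
apply: (@unitmx_mul0 _ _ (comb_mx M a b)).
  apply/lt0r_neq0/P_matrix_det_comb_gt0 => // i; rewrite /a /b /s; split=> //.
    by case: ifP.
  case: ifP => [_|/negbT]; first by rewrite ltr_wpDr.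
  rewrite negb_and => /orP[] ?; first by rewrite ltr_pwDl // normr_gt0.
  by rewrite ltr_wpDl // normr_gt0.
apply/colP => i; rewrite !mxE.
under eq_bigr => j _ do rewrite mxE mulrDl -!mulrA.
rewrite big_split /= -!mulr_sumr (row_id_mul i (z ^~ 0)).
have -> : \sum_j M i j * z j 0 = w i by rewrite /w mxE.
have := zle i; rewrite -/(w i) /a /b /s => zw.
have [z0|z0] := eqVneq (z i 0) 0.
  rewrite z0 /= mulr0 addr0; case: eqP => [->|_]; first by rewrite mulr0.
  by rewrite normr0 mul0r.
have [zn|zp|z0'] := ltgtP (z i 0) 0; last by rewrite z0' eqxx in z0.
  have wp : 0 <= w i by rewrite -(nmulr_rle0 _ zn).
  rewrite (ltr0_norm zn) (ger0_norm wp) /=; ring.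
have wn : w i <= 0 by rewrite -(pmulr_rle0 _ zp).
rewrite (gtr0_norm zp) (ler0_norm wn) /=; ring.
Qed.

(** * Complementarity: uniqueness and existence for P-matrices *)

Lemma best_replyP (R : realType) (n : nat) (G : 'M[R]_n) (q x : 'cV[R]_n) :
  best_reply G q x <->
  forall i, [/\ 0 <= x i 0, 0 <= ((1%:M + G) *m x - q) i 0
              & x i 0 * ((1%:M + G) *m x - q) i 0 = 0].
Proof.
have E i : ((1%:M + G) *m x - q) i 0 = x i 0 - (q - G *m x) i 0.
  by rewrite mulmxDl mul1mx !mxE; ring.
split=> [[xge xmax] i|xw].
  rewrite E; have := xmax i; have := xge i.
  by case: (lerP 0 ((q - G *m x) i 0)) => ? ? xi; split; rewrite ?xi; nra.
split=> i; have [x0] := xw i; first by [].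
rewrite E subr_ge0 => w0 /eqP; rewrite mulf_eq0 subr_eq0 => xy.
case: (lerP 0 ((q - G *m x) i 0)) => y0; case/orP: xy => /eqP x1 //; lra.
Qed.

Lemma P_matrix_best_reply_uniq (R : realType) (n : nat) (G : 'M[R]_n) (q x y : 'cV[R]_n) :
  P_matrix (1%:M + G) -> best_reply G q x -> best_reply G q y -> x = y.
Proof.
move=> PM /best_replyP xP /best_replyP yP.
apply/subr0_eq/(P_matrix_sign_reversal PM) => i.
have [x0 v0 xv] := xP i; have [y0 w0 yw] := yP i.
have -> : ((1%:M + G) *m (x - y)) i 0 =
    ((1%:M + G) *m x - q) i 0 - ((1%:M + G) *m y - q) i 0.
  by rewrite mulmxBr !mxE; ring.
(* With residuals [v] of [x] and [w] of [y], complementarity reduces [(x - y)(v - w)] to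
   [- x w - y v], which is nonpositive. *)
rewrite [X in X * _]mxE [(- y) _ _]mxE; nra.
Qed.

(** Induction on [C]: an index [k] of [C] is pinned once to [x k = 0] and once to a zero residual,
    and one of the two solutions fits. For empty [C] this is a linear system with matrix
    [mix_mx M A]. *)
Lemma P_matrix_pinned_solution (R : realType) (n : nat) (M : 'M[R]_n) (q : 'cV[R]_n)
    (C A : {set 'I_n}) :
  P_matrix M -> [disjoint C & A] ->
  exists x : 'cV[R]_n, forall i, let w := (M *m x - q) i 0 in
    if i \in C then [/\ 0 <= x i 0, 0 <= w & x i 0 * w = 0]
    else if i \in A then w = 0 else x i 0 = 0.
Proof.
move=> PM; have [m] := ubnP #|C|; elim: m C A => // m IHm C A; rewrite ltnS => leC dCA.
have [->|[k kC]] := set_0Vmem C.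
  have uM : mix_mx M A \in unitmx.
    by rewrite unitmxE unitfE lt0r_neq0 //; move/P_matrix_mixP: PM; exact.
  exists (invmx (mix_mx M A) *m \col_i (if i \in A then q i 0 else 0)) => i /=.
  set x := _ *m _; rewrite inE.
  have := mix_mx_mul M A x i; rewrite mulKVmx // !mxE.
  by case: ifP => // _ <-; rewrite subrr.
have kA : k \notin A by rewrite (disjointFr dCA kC).
have lt1 : (#|C :\ k| < m)%N.
  by apply: leq_trans leC; rewrite (cardsD1 k C) kC.
have [|x xP] := IHm (C :\ k) A lt1.
  by apply: disjointWl dCA; exact: finset.subsetDl.
have [|y yP] := IHm (C :\ k) (k |: A) lt1.
  rewrite finset.disjoints_subset; apply/fintype.subsetP => i.
  by rewrite !inE negb_or => /andP[-> iC]; rewrite (disjointFr dCA iC).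
have := xP k; rewrite !inE eqxx /= (negbTE kA) => xk.
have := yP k; rewrite !inE eqxx /= => wyk.
have [wk|wk] := lerP 0 ((M *m x - q) k 0).
  exists x => i /=; case: (eqVneq i k) => [->|ik].
    by rewrite kC xk mul0r; split.
  by have := xP i; rewrite !inE ik.
(* Here the residual of [x] at [k] is negative. If [y k] were negative too, [x - y] would be
   sign-reversed by [M], hence zero, against [x k = 0]. *)
have yk : 0 <= y k 0.
  rewrite leNgt; apply/negP => yk.
  suff /colP/(_ k) : x - y = 0 by rewrite !mxE xk; lra.
  apply: (P_matrix_sign_reversal PM) => i.
  have -> : (M *m (x - y)) i 0 = (M *m x - q) i 0 - (M *m y - q) i 0.
    by rewrite mulmxBr !mxE; ring.
  rewrite [X in X * _]mxE [(- y) _ _]mxE.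
  have [->|ik] := eqVneq i k; first by rewrite xk wyk; nra.
  have := xP i; have := yP i; rewrite /= !inE ik /= (negbTE ik) /=.
  case: ifP => _; first by move=> [? ? ?] [? ? ?]; nra.
  by case: ifP => _ -> ->; rewrite subrr ?mulr0 ?mul0r.
exists y => i /=; case: (eqVneq i k) => [->|ik].
  by rewrite kC wyk mulr0; split.
by have := yP i; rewrite !inE ik (negbTE ik).
Qed.

Lemma P_matrix_best_reply_exists (R : realType) (n : nat) (G : 'M[R]_n) (q : 'cV[R]_n) :
  P_matrix (1%:M + G) -> exists x, best_reply G q x.
Proof.
move=> PM.
have [|x xP] := @P_matrix_pinned_solution _ _ _ q [set: 'I_n]%SET finset.set0 PM.
  by rewrite -finset.setI_eq0 finset.setI0.
by exists x; apply/best_replyP => i; have := xP i; rewrite inE.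
Qed.

(** * Two best replies without the P-property *)

Lemma not_P_matrix_two_best_replies (R : realType) (n : nat) (G : 'M[R]_n) :
  ~ P_matrix (1%:M + G) ->
  exists q x y, [/\ x <> y, best_reply G q x & best_reply G q y].
Proof.
set M := 1%:M + G => nPM.
have [A detA] : exists A, \det (mix_mx M A) <= 0.
  apply: contrapT => nA; apply: nPM; apply/P_matrix_mixP => A.
  by rewrite ltNge; apply/negP => leA; apply: nA; exists A.
have [{detA}B /minsetP[detB minB] _] :=
  minset_exists (P := fun A => \det (mix_mx M A) <= 0) detA.
have [B0|[k kB]] := set_0Vmem B.
  have : mix_mx M B = 1%:M by apply/matrixP => i j; rewrite B0 !mxE inE.
  by move=> E; move: detB; rewrite E det1; lra.
set C := B :\ k.
have detC : 0 < \det (mix_mx M C).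
  rewrite ltNge; apply/negP => leC.
  by have := minB _ leC (finset.subsetDl _ _) => CB; move: kB; rewrite -CB !inE eqxx.
pose z := col k (\adj (mix_mx M C)).
have mulz i : (mix_mx M C *m z) i 0 = \det (mix_mx M C) *+ (i == k).
  by rewrite /z colE mulmxA mul_mx_adj mul_scalar_mx !mxE andbT mulr_natr.
have zk : z k 0 = \det (mix_mx M C).
  by have := mulz k; rewrite mix_mx_mul !inE eqxx.
(* [mix_mx M B] and [mix_mx M C] differ only in row [k], so their cofactors along that row agree,
   and these are the entries of [z]. *)
have Mzk : (M *m z) k 0 = \det (mix_mx M B).
  rewrite (expand_det_row _ k) mxE; apply: eq_bigr => j _.
  rewrite !mxE kB /cofactor; congr (_ * (_ * \det _)).
  apply/matrixP => i l; rewrite !mxE !inE.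
  by rewrite (eq_sym _ k) neq_lift.
have zB i : i \in C -> (M *m z) i 0 = 0.
  move=> iC; have := mulz i; rewrite mix_mx_mul iC; case: eqP => // ik.
  by rewrite ik !inE eqxx in iC.
have zN i : i \notin B -> z i 0 = 0.
  move=> iB; have := mulz i; rewrite mix_mx_mul inE (negbTE iB) andbF.
  by case: eqP => // ik; rewrite -ik (negbTE iB) in kB.
(* The residuals of [x] and [x + z] will be [v] and [v + M z]. On [C] both residuals vanish and
   [|z|] keeps both efforts nonnegative; at [k] the effort rises from 0 while the residual drops to
   0; outside [B] both efforts are 0 and [|M z|] keeps the residuals nonnegative. *)
pose x : 'cV[R]_n := \col_i (if i \in C then `|z i 0| else 0).
pose v : 'cV[R]_n := \col_i (if i \in C then 0
    else if i == k then - (M *m z) k 0 else `|(M *m z) i 0|).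
have xE i : x i 0 = if i \in C then `|z i 0| else 0 by rewrite mxE.
have vE i : v i 0 = if i \in C then 0
    else if i == k then - (M *m z) k 0 else `|(M *m z) i 0| by rewrite mxE.
have inC i : (i \in C) = (i != k) && (i \in B) by rewrite !inE.
exists (M *m x - v), x, (x + z); split.
- move=> /colP/(_ k); rewrite [RHS]mxE zk; lra.
- apply/best_replyP => i; rewrite -/M opprB addrCA subrr addr0 xE vE.
  case: ifP => iC; first by rewrite mulr0; split.
  rewrite mul0r; split=> //; case: eqP => // _.
  by rewrite Mzk oppr_ge0.
- apply/best_replyP => i; rewrite -/M.
  have -> : (M *m (x + z) - (M *m x - v)) i 0 = v i 0 + (M *m z) i 0.
    by rewrite mulmxDr !mxE; ring.
  rewrite [(x + z) i 0]mxE xE vE inC.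
  have [->|ik] := eqVneq i k.
    by rewrite /= zk add0r addNr mulr0; split=> //; exact: ltW.
  have [iB|iB] := boolP (i \in B); rewrite /=.
    rewrite zB ?inC ?ik // addr0 mulr0; split=> //.
    by have := ler_norm (- z i 0); rewrite normrN; lra.
  rewrite zN // addr0 mul0r; split=> //.
  by have := ler_norm (- (M *m z) i 0); rewrite normrN; lra.
Qed.

(** * Block matrices and Schur complements *)

(** For an index set inside the first block, all rows of the second block become identity rows,
    which leaves the determinant of [mix_mx A S]. *)
Lemma P_matrix_block_ul (R : realType) (m n : nat) (A : 'M[R]_m) (B : 'M[R]_(m, n))
    (C : 'M[R]_(n, m)) (D : 'M[R]_n) :
  P_matrix (block_mx A B C D) -> P_matrix A.
Proof.
move=> /P_matrix_mixP PM; apply/P_matrix_mixP => S.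
have := PM (@lshift m n @: S).
set X := mix_mx _ _; suff -> : X = block_mx (mix_mx A S) (ursubmx X) 0 1%:M.
  by rewrite det_ublock det1 mulr1.
rewrite -[LHS]submxK; congr block_mx; apply/matrixP => i j;
  rewrite 2![LHS]mxE [LHS]mxE
    ?block_mxEul ?block_mxEdl ?block_mxEdr ?block_mxEur [RHS]mxE.
- by rewrite (mem_imset _ _ (@lshift_inj _ _)) eq_lshift.
- rewrite ifF ?eq_rlshift //.
  by apply/imsetP => -[l _ /eqP]; rewrite eq_rlshift.
- rewrite ifF ?eq_rshift //.
  by apply/imsetP => -[l _ /eqP]; rewrite eq_rlshift.
Qed.

Lemma P_matrix_block_dr (R : realType) (m n : nat) (A : 'M[R]_m) (B : 'M[R]_(m, n))
    (C : 'M[R]_(n, m)) (D : 'M[R]_n) :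
  P_matrix (block_mx A B C D) -> P_matrix D.
Proof.
move=> /P_matrix_mixP PM; apply/P_matrix_mixP => S.
have := PM (@rshift m n @: S).
set X := mix_mx _ _; suff -> : X = block_mx 1%:M 0 (dlsubmx X) (mix_mx D S).
  by rewrite det_lblock det1 mul1r.
rewrite -[LHS]submxK; congr block_mx; apply/matrixP => i j;
  rewrite 2![LHS]mxE [LHS]mxE
    ?block_mxEul ?block_mxEdl ?block_mxEdr ?block_mxEur [RHS]mxE.
- rewrite ifF ?eq_lshift //.
  by apply/imsetP => -[l _ /eqP]; rewrite eq_lrshift.
- rewrite ifF ?eq_lrshift //.
  by apply/imsetP => -[l _ /eqP]; rewrite eq_lrshift.
- by rewrite (mem_imset _ _ (@rshift_inj _ _)) eq_rshift.
Qed.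

Lemma P_matrix_det_gt0 (R : realType) (n : nat) (M : 'M[R]_n) :
  P_matrix M -> 0 < \det M.
Proof.
move=> /P_matrix_mixP/(_ [set: 'I_n]%SET); congr (_ < \det _).
by apply/matrixP => i j; rewrite mxE inE.
Qed.

Lemma P_matrix_unitmx (R : realType) (n : nat) (M : 'M[R]_n) :
  P_matrix M -> M \in unitmx.
Proof. by move=> PM; rewrite unitmxE unitfE lt0r_neq0 // P_matrix_det_gt0. Qed.

Lemma det_block_schur_dr (R : comUnitRingType) (m n : nat) (A : 'M[R]_m) (B : 'M[R]_(m, n))
    (C : 'M[R]_(n, m)) (D : 'M[R]_n) :
  D \in unitmx ->
  \det (block_mx A B C D) = \det (A - B *m invmx D *m C) * \det D.
Proof.
move=> uD; have -> : block_mx A B C D =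
    block_mx 1%:M (B *m invmx D) 0 1%:M *m block_mx (A - B *m invmx D *m C) 0 C D.
  by rewrite mulmx_block !mul1mx !mul0mx !add0r subrK mulmxKV.
by rewrite det_mulmx det_ublock det_lblock !det1 !mul1r.
Qed.

Lemma det_block_schur_ul (R : comUnitRingType) (m n : nat) (A : 'M[R]_m) (B : 'M[R]_(m, n))
    (C : 'M[R]_(n, m)) (D : 'M[R]_n) :
  A \in unitmx ->
  \det (block_mx A B C D) = \det A * \det (D - C *m invmx A *m B).
Proof.
move=> uA; have -> : block_mx A B C D =
    block_mx 1%:M 0 (C *m invmx A) 1%:M *m block_mx A B 0 (D - C *m invmx A *m B).
  rewrite mulmx_block !mul1mx !mul0mx !addr0 mulmxKV //.
  by rewrite addrC subrK.
by rewrite det_mulmx det_ublock det_lblock !det1 !mul1r.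
Qed.

Lemma add1_block_mx (R : pzRingType) (m n : nat) (A : 'M[R]_m) (B : 'M[R]_(m, n))
    (C : 'M[R]_(n, m)) (D : 'M[R]_n) :
  1%:M + block_mx A B C D = block_mx (1%:M + A) B C (1%:M + D).
Proof. by rewrite scalar_mx_block add_block_mx !add0r. Qed.

(** * Strict concavity and injectivity of the derivative *)

Lemma strictly_concave_lt_tangent (R : realType) (b : R -> R) (x y : R) :
  derivable b x 1 -> strictly_concave b -> x != y ->
  b y - b x < (y - x) * b^`()%classic x.
Proof.
move=> db bc xy.
(* For [0 < h < 1] concavity bounds the difference quotient towards [z] below by [b z - b x]; the
   limit from the right keeps the bound. *)
have tangent z : x != z -> b z - b x <= (z - x) * b^`()%classic x.
  move=> xz; have /derivable1_diffP dfb := db.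
  have -> : (z - x) * b^`()%classic x = 'D_(z - x) b x by rewrite deriveE// diff1E.
  have := @diff_derivable _ _ _ b x (z - x) dfb; rewrite /derivable => /cvg_ex[l bl].
  rewrite /derive (cvg_lim _ bl)//.
  have {}bl := cvg_dnbhs_at_right bl.
  rewrite -(cvg_lim (@norm_hausdorff _ R) bl).
  apply: limr_ge; first by apply/cvg_ex; exists l.
  near=> h.
  have h0 : 0 < h by near: h; exact: nbhs_right_gt.
  have h1 : h < 1 by near: h; exact: nbhs_right_lt.
  rewrite /= -[_ *: _]/(h^-1 * _) mulrC ler_pdivlMr //.
  have zx : z != x by rewrite eq_sym.
  have := bc z x h zx h0 h1.
  rewrite -[h *: _]/(h * _).
  have -> : h * z + (1 - h) * x = h * (z - x) + x by ring.
  by nra.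
(* Strictness comes from the midpoint of [x] and [y], where [b] lies strictly above the chord but
   not above the tangent. *)
have h2 : 0 < 2^-1 :> R by rewrite invr_gt0.
have h3 : 2^-1 < 1 :> R by lra.
have := bc x y 2^-1 xy h2 h3.
set m := _ * x + _.
have : x != m.
  apply: contra xy => /eqP xm; apply/eqP.
  by rewrite /m in xm; lra.
move=> /tangent; rewrite {2}/m; lra.
Unshelve. all: by end_near. Qed.

Lemma strictly_concave_derive_inj (R : realType) (b : R -> R) :
  (forall x, derivable b x 1) -> strictly_concave b -> injective b^`()%classic.
Proof.
move=> db bc x y bxy; apply/eqP; apply: contraT => xy.
have t1 := strictly_concave_lt_tangent (db x) bc xy.
have yx : y != x by rewrite eq_sym.
have t2 := strictly_concave_lt_tangent (db y) bc yx.
by rewrite bxy in t1; lra.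
Qed.

(** * Exponential benefits and realization of targets *)

Definition exp_benefit (R : realType) (x : R) : R := - expR (- x).

Lemma is_derive_expRN (R : realType) (x : R) :
  is_derive x 1 (fun y => expR (- y)) (- expR (- x)).
Proof.
have := is_derive1_comp (is_derive_expR (- x)) (is_deriveNid x (1 : R)).
by rewrite mulrN1.
Qed.

Lemma is_derive_exp_benefit (R : realType) (x : R) :
  is_derive x 1 (@exp_benefit R) (expR (- x)).
Proof.
by rewrite -[X in is_derive _ _ _ X]opprK; apply: is_deriveN; exact: is_derive_expRN.
Qed.

Lemma derive_exp_benefit (R : realType) :
  (@exp_benefit R)^`()%classic = fun x => expR (- x).
Proof.
apply/funext => x; rewrite derive1E.
exact: (@derive_val _ _ _ _ _ _ _ (is_derive_exp_benefit x)).
Qed.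

Lemma admissible_exp_benefit (R : realType) (q : R) :
  admissible (@exp_benefit R) (expR (- q)).
Proof.
split.
- split=> x; first by have [] := is_derive_exp_benefit x.
  by rewrite derive_exp_benefit; have [] := is_derive_expRN x.
- by move=> x y xy; rewrite /exp_benefit ltrN2 ltr_expR ltrN2.
- move=> x y t xy t0 t1; rewrite /exp_benefit.
  set m := t * x + _.
  (* After factoring out [expR (- m)], the bound [1 + u <= expR u] suffices, strict for nonzero [u],
     because the weighted mean of [m - x] and [m - y] is 0. *)
  have E z : expR (- z) = expR (- m) * expR (m - z).
    by rewrite -expRD; congr expR; ring.
  have mx : m - x != 0.
    have -> : m - x = (1 - t) * (y - x) by rewrite /m; ring.
    by rewrite mulf_neq0 // ?subr_eq0 1?eq_sym // lt_eqF.
  have ex := expR_gt1Dx mx.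
  have ey := expR_ge1Dx (m - y).
  rewrite (E x) (E y).
  have em := expR_gt0 (- m).
  suff : 1 < t * expR (m - x) + (1 - t) * expR (m - y) by nra.
  have p1 : t * (1 + (m - x)) < t * expR (m - x) by rewrite ltr_pM2l.
  have p2 : (1 - t) * (1 + (m - y)) <= (1 - t) * expR (m - y).
    by rewrite ler_pM2l // subr_gt0.
  rewrite /m in p1 p2 *; nra.
- exact: expR_gt0.
- by exists q; rewrite derive_exp_benefit.
Qed.

Lemma target_exp_benefit (R : realType) (n : nat) (q : 'cV[R]_n) :
  target (fun=> @exp_benefit R) (fun i => expR (- q i 0)) q.
Proof. by move=> i; rewrite derive_exp_benefit. Qed.

Lemma target_uniq (R : realType) (n : nat) (b : 'I_n -> R -> R) (c : 'I_n -> R)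
    (q q' : 'cV[R]_n) :
  (forall i, admissible (b i) (c i)) -> target b c q -> target b c q' -> q = q'.
Proof.
move=> adm tq tq'; apply/colP => i.
have [[db _] _ bc _ _] := adm i.
by apply: (strictly_concave_derive_inj db bc); rewrite tq tq'.
Qed.

Lemma target_exists (R : realType) (n : nat) (b : 'I_n -> R -> R) (c : 'I_n -> R) :
  (forall i, admissible (b i) (c i)) -> exists q, target b c q.
Proof.
move=> adm.
have [q qP] := choice (fun i : 'I_n => let: And5 _ _ _ _ e := adm i in e).
by exists (\col_i q i) => i; rewrite mxE.
Qed.

(** * Guaranteed uniqueness and the two-layer game *)

Lemma layer_guaranteed_unique_nashP (R : realType) (n : nat) (G : 'M[R]_n) :
  layer_guaranteed_unique_nash G <-> P_matrix (1%:M + G).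
Proof.
split=> [uniqG|PM b c adm].
  apply: contrapT => /not_P_matrix_two_best_replies[q [x [y [xy xP yP]]]]; apply: xy.
  have [|z [_ zP]] := uniqG (fun=> @exp_benefit R) (fun i => expR (- q i 0)).
    by move=> i; exact: admissible_exp_benefit.
  by apply: etrans (esym (zP x _)) (zP y _);
    exists q; split=> //; exact: target_exp_benefit.
have [q tq] := target_exists adm.
have [x xP] := P_matrix_best_reply_exists q PM.
exists x; split=> [|y [q' [tq' yP]]]; first by exists q.
apply: (P_matrix_best_reply_uniq PM xP).
by rewrite (target_uniq adm tq tq').
Qed.

Theorem proposition5 (R : realType) (N : nat) (G1 G2 G12 G21 : 'M[R]_N)
    (hG1 : forall i : 'I_N, G1 i i = 0) (hG2 : forall i : 'I_N, G2 i i = 0) :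
  ((~ P_matrix (1%:M + G1) \/ ~ P_matrix (1%:M + G2)) <->
   (~ layer_guaranteed_unique_nash G1 \/ ~ layer_guaranteed_unique_nash G2)) /\
  ((~ P_matrix (1%:M + G1) \/ ~ P_matrix (1%:M + G2)) \/
   [/\ P_matrix (1%:M + G1), P_matrix (1%:M + G2)
     & \det (1%:M + G1 - G12 *m invmx (1%:M + G2) *m G21) <= 0 \/
       \det (1%:M + G2 - G21 *m invmx (1%:M + G1) *m G12) <= 0] ->
   exists (b1 : 'I_N -> R -> R) (c1 : 'I_N -> R)
          (b2 : 'I_N -> R -> R) (c2 : 'I_N -> R),
     [/\ forall i : 'I_N, admissible (b1 i) (c1 i),
         forall i : 'I_N, admissible (b2 i) (c2 i)
       & (~ exists x : 'cV[R]_(N + N), multilayer_nash G1 G12 G21 G2 b1 c1 b2 c2 x) \/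
         (exists x y : 'cV[R]_(N + N),
            [/\ x <> y, multilayer_nash G1 G12 G21 G2 b1 c1 b2 c2 x
              & multilayer_nash G1 G12 G21 G2 b1 c1 b2 c2 y])]).
Proof.
split; first by rewrite !layer_guaranteed_unique_nashP.
move=> nP.
have nPM : ~ P_matrix (1%:M + block_mx G1 G12 G21 G2).
  rewrite add1_block_mx => PM.
  case: nP => [[]|[P1 P2 schur]].
  - by apply; exact: P_matrix_block_ul PM.
  - by apply; exact: P_matrix_block_dr PM.
  (* The block determinant is the Schur complement's determinant times that of a diagonal block;
     both it and the latter are positive, so the former must be. *)
  have := P_matrix_det_gt0 PM; case: schur => schur.
    rewrite det_block_schur_dr ?P_matrix_unitmx // (pmulr_lgt0 _ (P_matrix_det_gt0 P2)).
    by rewrite ltNge schur.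
  rewrite det_block_schur_ul ?P_matrix_unitmx // (pmulr_rgt0 _ (P_matrix_det_gt0 P1)).
  by rewrite ltNge schur.
have [q [x [y [xy xP yP]]]] := not_P_matrix_two_best_replies nPM.
exists (fun=> @exp_benefit R), (fun i => expR (- usubmx q i 0)).
exists (fun=> @exp_benefit R), (fun i => expR (- dsubmx q i 0)).
split; [by move=> i; exact: admissible_exp_benefit.. | right].
exists x, y; split=> //; exists (usubmx q), (dsubmx q);
  by split; rewrite ?vsubmxK //; exact: target_exp_benefit.
Qed.
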